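(* Let $(\mathcal U,U,V,V,Z)$ be a CR dual system of metric $f$-structures. Let $\mathscr H$ be a $V$-Hilbert $U$-module satisfying $$\mathsf d_{\mathscr H}(v,0)^2\le\mathsf d_Z(|v|^2,0)\quad\text{for every }v\in\mathscr H.$$ Let $C\ne\varnothing$ be a closed, convex subset of $\mathscr H$ such that $\mathscr G(C)=C$. Let $v\in\mathscr H$ be fixed and define $$|v-C|:=\inf\{|v-w|:w\in C\}\in V^+,\qquad\mathsf d_{\mathscr H}(v,C):=\inf\{\mathsf d_{\mathscr H}(v,w):w\in C\}\in\mathbb R^+.$$ Then $\mathsf d_V(|v-C|,0)=\mathsf d_{\mathscr H}(v,C)$. Moreover, there exists a unique element $P_C(v)\in C$ (the orthogonal projection of $v$ onto $C$) such that $|v-C|=|v-P_C(v)|$.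
   Context: Riesz spaces and $f$-algebras. $\mathbb R^+=[0,\infty)$. A Riesz space is a real vector space $U$ with a partial order that is a lattice and satisfies $u\le v\Rightarrow u+w\le v+w$ and ($u\ge 0$, $\lambda\in\mathbb R^+$) $\Rightarrow\lambda u\ge 0$; $\vee,\wedge$ denote sup and inf of two elements, $u^{+}=u\vee 0$, $u^-=(-u)\vee 0$, $|u|=u\vee(-u)$, $U^+=\{u\in U:u\ge 0\}$. A Riesz subspace is a linear subspace closed under $\vee,\wedge$; a Riesz subspace $V\subset U$ is solid if $v\in U$, $u\in V$, $|v|\le|u|$ imply $v\in V$. A family is disjoint if $|u|\wedge|v|=0$ for any two different members. Dedekind complete (resp. $\sigma$-complete): every non-empty (resp. countable non-empty) subset bounded above has a supremum and every such subset bounded below has an infimum. A Dedekind complete partially ordered set $P$ is countably representable (CR) if every non-empty $S\subset P$ bounded above contains a sequence $(s_n)_n\subset S$ with $\sup_ns_n=\sup S$ and every non-empty $S\subset P$ bounded below contains a sequence $(s_n)_n\subset S$ with $\inf_ns_n=\inf S$. An $f$-algebra is a Riesz space with an associative, commutative, $\mathbb R$-bilinear multiplication with unit $\mathbf 1_U$ such that $uv\ge0$ for $u,v\ge 0$, and $(uw)\wedge v=0$ whenever $u\wedge v=0$ and $w\ge 0$. An $f$-subalgebra is a Riesz subspace closed under multiplication and containing $\mathbf 1_U$. $\mathrm{Idem}(U)=\{u\in U:u^2=u\}$. A finite partition of $u\in\mathrm{Idem}(U)$ is a finite disjoint family in $\mathrm{Idem}(U)$ with sum $u$; a countable partition of $u$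 is a disjoint family $(u_n)_{n\in\mathbb N}\subset\mathrm{Idem}(U)$ with $\sup_n u_n=u$; $\mathcal P(u)$ is the set of countable partitions of $u$. Simple elements: $\mathcal S(U)=\{\sum_{i=1}^n\lambda_iu_i:\lambda_i\in\mathbb R,\ (u_i)_{i=1}^n\text{ a finite partition of }\mathbf 1_U\}$. An order-preserving map is $\sigma$-order-continuous if it preserves existing suprema of non-decreasing sequences and existing infima of non-increasing sequences; it is order-continuous if it preserves existing suprema of upwards directed sets and existing infima of downwards directed sets. A localisable $f$-algebra is a Dedekind $\sigma$-complete $f$-algebra whose multiplication is $\sigma$-order-continuous on $U^+\times U^+$ and such that every $u\in U^+$ is the supremum of a non-decreasing sequence in $\mathcal S(U)\cap U^+$. Metric notions (products of metric spaces carry the sum distance). A metric Riesz space $(U,\mathsf d_U)$ is a Dedekind $\sigma$-complete Riesz space with a complete distance such that $\mathsf d_U(u,0)=\mathsf d_U(|u|,0)$, $\mathsf d_U(u+w,v+w)=\mathsf d_U(u,v)$, and $\mathsf d_U(u,0)\le\mathsf d_U(v,0)$ whenever $0\le u\le v$. A metric $f$-algebra is a localisable $f$-algebra $U$ with a distance $\mathsf d_U$ such that $(U,\mathsf d_U)$ is a metric Riesz space, the multiplication $U\times U\to U$ is continuous, $\mathcal S(U)$ is dense, and $\mathsf d_U(\varepsilon\mathbf 1_U,0)\to0$ as $\varepsilon\searrow0$. A metric $f$-structure is a triple $(\mathcal U,U,V)$ where $\mathcal U$ is a localisable $f$-algebra; $(U,\mathsf d_U)$ is a metric $f$-algebra that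 is a solid $f$-subalgebra of $\mathcal U$; $(V,\mathsf d_V)$ is a metric Riesz space that is a solid Riesz subspace of $\mathcal U$; $UV=V$ (where $UV=\{uv:u\in U,v\in V\}$) and the multiplication $U\times V\to V$ is continuous; and for any $(u_n)_n\in\mathcal P(\mathbf 1_U)$ and $\varepsilon>0$ there is $\delta>0$ such that, whenever $(v_n)_n\subset V^+$ satisfies $\sum_n\mathsf d_V(u_nv_n,0)\le\delta$, the family $(u_nv_n)_n$ is order-bounded in $V$ and $\mathsf d_V(\sup_nu_nv_n,0)\le\varepsilon$. It is CR if $\mathcal U$, $U$ and $V$ are CR. A dual system of metric $f$-structures is a quintuplet $(\mathcal U,U,V,W,Z)$ such that $(\mathcal U,U,V)$, $(\mathcal U,U,W)$, $(\mathcal U,U,Z)$ are metric $f$-structures, $Z=VW$ and the multiplication $V\times W\to Z$ is continuous. It is complete if in addition $U,V,W,Z$ are Dedekind complete and the multiplication is order-continuous from $U^+\times V^+$ to $V^+$, from $U^+\times W^+$ to $W^+$, from $U^+\times Z^+$ to $Z^+$ and from $V^+\times W^+$ to $Z^+$. It is CR if it is complete and moreover $(\mathcal U,U,V)$, $(\mathcal U,U,W)$, $(\mathcal U,U,Z)$ are CR. Modules. A $V$-normed $U$-module over a metric $f$-structure $(\mathcal U,U,V)$ is a $U$-module $\mathscr M$ (a real vector space via $\lambda v=(\lambda\mathbf 1_U)\cdot v$) with a map $|\cdot|\colon\mathscr M\to V^+$ such that $|v|=0\iff v=0$, $|v+w|\le|v|+|w|$, $|u\cdot v|=|u||v|$,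 and the glueing property holds: if $(u_n)_n\in\mathcal P(\mathbf 1_U)$ and $(v_n)_n\subset\mathscr M$ are such that $(|u_n\cdot v_n|)_n$ is order-bounded in $V$ (one writes $(u_n,v_n)_n\in\mathrm{Adm}(\mathscr M)$), then there is a (necessarily unique) $v\in\mathscr M$ with $u_n\cdot v=u_n\cdot v_n$ for all $n$, denoted $\sum_{n\in\mathbb N}u_n\cdot v_n$. $\mathscr M$ has the distance $\mathsf d_{\mathscr M}(v,w)=\mathsf d_V(|v-w|,0)$; if it is complete, $\mathscr M$ is a $V$-Banach $U$-module. For $\varnothing\ne S\subset\mathscr M$, $\mathscr G(S)=\{\sum_nu_n\cdot v_n:(u_n)_n\in\mathcal P(\mathbf 1_U),(v_n)_n\subset S,(u_n,v_n)_n\in\mathrm{Adm}(\mathscr M)\}$. Hilbert modules. For a dual system $(\mathcal U,U,V,V,Z)$, a $V$-Hilbert $U$-module is a $V$-Banach $U$-module $\mathscr H$ with $|v+w|^2+|v-w|^2=2|v|^2+2|w|^2$ (an identity in $Z$) for all $v,w\in\mathscr H$. *)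

(* Defs.v *)
From HB Require Import structures.
From mathcomp Require Import all_boot all_order all_algebra.
From mathcomp Require Import all_classical all_reals all_analysis.

Set Implicit Arguments.
Unset Strict Implicit.
Unset Printing Implicit Defensive.

Import Order.TTheory GRing.Theory Num.Theory.
Import numFieldNormedType.Exports.

Local Open Scope classical_set_scope.
Local Open Scope ring_scope.

(* The lattice operations, and the multiplication of an f-algebra, are fields
   of the mixins below rather than [Order.Lattice] and [GRing.ComPzRing]
   structures: Hierarchy Builder rejects a structure joining [Order.Lattice],
   [GRing.PzRing] or [Metric] with [Num.POrderedZmodule] once
   [Num.NumDomain], [Num.RealDomain] and [PseudoMetricNormedZmod] exist (missing
   joins).  The ring and metric structures are recovered on the aliases [fring]
   and [metr]. *)

Reserved Notation "u \join v" (at level 50, left associativity).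
Reserved Notation "u \meet v" (at level 48, left associativity).
Reserved Notation "u ** v" (at level 40, left associativity).

HB.mixin Record POrderedLmodule_isRiesz (R : realType) V
    of Num.POrderedZmodule V & GRing.Lmodule R V := {
  rjoin : V -> V -> V ;
  rmeet : V -> V -> V ;
  rjoin_le : forall u v w : V, (rjoin u v <= w) = (u <= w) && (v <= w) ;
  le_rmeet : forall u v w : V, (w <= rmeet u v) = (w <= u) && (w <= v) ;
  riesz_leD2r : forall u v w : V, u <= v -> u + w <= v + w ;
  riesz_scale_ge0 : forall (a : R) (u : V), 0 <= a -> 0 <= u -> 0 <= a *: u
}.

#[short(type="rieszType")]
HB.structure Definition Riesz (R : realType) :=
  { V of Num.POrderedZmodule V & GRing.Lmodule R V
       & POrderedLmodule_isRiesz R V }.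

Notation "u \join v" := (rjoin u v) : ring_scope.
Notation "u \meet v" := (rmeet u v) : ring_scope.

Definition rabs (R : realType) (V : rieszType R) (u : V) : V := u \join - u.

HB.mixin Record Riesz_isFAlgebra (R : realType) A of Riesz R A := {
  fmul : A -> A -> A ;
  fone : A ;
  fmulA : associative fmul ;
  fmulC : commutative fmul ;
  fmul1 : left_id fone fmul ;
  fmulDl : left_distributive fmul +%R ;
  fscaleAl : forall (a : R) (u v : A), a *: fmul u v = fmul (a *: u) v ;
  fmul_ge0 : forall u v : A, 0 <= u -> 0 <= v -> 0 <= fmul u v ;
  fmul_meet : forall u v w : A,
    rmeet u v = 0 -> 0 <= w -> rmeet (fmul u w) v = 0
}.

#[short(type="fAlgType")]
HB.structure Definition FAlgebra (R : realType) :=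
  { A of Riesz R A & Riesz_isFAlgebra R A }.

Notation "u ** v" := (fmul u v) : ring_scope.

Definition fring (R : realType) (A : fAlgType R) : Type := A.

HB.instance Definition _ (R : realType) (A : fAlgType R) :=
  GRing.Zmodule.on (fring A).
HB.instance Definition _ (R : realType) (A : fAlgType R) :=
  GRing.Zmodule_isComPzRing.Build (fring A)
    (@fmulA R A) (@fmulC R A) (@fmul1 R A) (@fmulDl R A).

Record distance (R : realType) (T : Type) := Distance {
  dist :> T -> T -> R ;
  distxx : forall x, dist x x = 0 ;
  dist_positivity : forall x y, dist x y = 0 -> x = y ;
  dist_sym : forall x y, dist x y = dist y x ;
  dist_triangle : forall y x z, dist x z <= dist x y + dist y z
}.

Definition metr (R : realType) (T : choiceType) (d : distance R T) : Type := T.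

HB.instance Definition _ (R : realType) (T : choiceType) (d : distance R T) :=
  Choice.on (metr d).
HB.instance Definition _ (R : realType) (T : choiceType) (d : distance R T) :=
  isMetric.Build R (metr d) (distxx d) (dist_positivity (d := d)) (dist_sym d)
    (dist_triangle d).

Definition complete_dist (R : realType) (T : choiceType) (d : distance R T) :=
  forall F : set_system (metr d), ProperFilter F -> cauchy F ->
    exists l : metr d, F --> l.

Section order_notions.
Context {d : Order.disp_t} (P : porderType d).

Definition dedekind_complete :=
  (forall S : set P, S !=set0 -> has_ubound S -> supremums S !=set0) /\
  (forall S : set P, S !=set0 -> has_lbound S -> infimums S !=set0).

Definition dedekind_sigma_complete :=
  (forall S : set P, countable S -> S !=set0 -> has_ubound S ->
    supremums S !=set0) /\
  (forall S : set P, countable S -> S !=set0 -> has_lbound S ->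
    infimums S !=set0).

Definition countably_representable :=
  [/\ dedekind_complete,
      forall S : set P, S !=set0 -> has_ubound S ->
        exists s : nat -> P, range s `<=` S /\
          supremums (range s) = supremums S &
      forall S : set P, S !=set0 -> has_lbound S ->
        exists s : nat -> P, range s `<=` S /\
          infimums (range s) = infimums S].

Definition order_bounded (S : set P) := has_lbound S /\ has_ubound S.

(* suprema and infima computed in the subset [D] with the induced order *)
Definition sup_in (D S : set P) (s : P) :=
  [/\ D s, ubound S s & forall t, D t -> ubound S t -> (s <= t)%O].

Definition inf_in (D S : set P) (s : P) :=
  [/\ D s, lbound S s & forall t, D t -> lbound S t -> (t <= s)%O].

Definition up_directed (S : set P) := S !=set0 /\
  forall x y, S x -> S y -> exists z, [/\ S z, (x <= z)%O & (y <= z)%O].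

Definition down_directed (S : set P) := S !=set0 /\
  forall x y, S x -> S y -> exists z, [/\ S z, (z <= x)%O & (z <= y)%O].

End order_notions.

Section order_continuity.
Context {d d' : Order.disp_t} (P : porderType d) (Q : porderType d').
Implicit Types (D : set P) (E : set Q) (f : P -> Q).

Definition order_preserving D E f :=
  (forall x, D x -> E (f x)) /\
  (forall x y, D x -> D y -> (x <= y)%O -> (f x <= f y)%O).

Definition sigma_order_continuous D E f :=
  [/\ order_preserving D E f,
      forall (x : nat -> P) s, range x `<=` D -> nondecreasing_seq x ->
        sup_in D (range x) s -> sup_in E (range (f \o x)) (f s) &
      forall (x : nat -> P) s, range x `<=` D -> nonincreasing_seq x ->
        inf_in D (range x) s -> inf_in E (range (f \o x)) (f s)].

Definition order_continuous D E f :=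
  [/\ order_preserving D E f,
      forall S s, S `<=` D -> up_directed S ->
        sup_in D S s -> sup_in E (f @` S) (f s) &
      forall S s, S `<=` D -> down_directed S ->
        inf_in D S s -> inf_in E (f @` S) (f s)].

End order_continuity.

Definition pos (R : realType) (V : rieszType R) : set V := [set u | 0 <= u].

Definition pos2 (R : realType) (V W : rieszType R) : set (V *p W) :=
  [set p | pos p.1 /\ pos p.2].

Section f_algebra.
Context (R : realType) (A : fAlgType R).

Definition idem : set A := [set u | u ** u = u].

Definition disjoint_family (I : Type) (p : I -> A) :=
  forall i j, i <> j -> rabs (p i) \meet rabs (p j) = 0.

Definition finite_partition (u : A) (n : nat) (p : 'I_n -> A) :=
  [/\ forall i, idem (p i), disjoint_family p & \sum_(i < n) p i = u].

Definition countable_partition (u : A) (p : nat -> A) :=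
  [/\ forall n, idem (p n), disjoint_family p & supremums (range p) u].

Definition simple_elts : set A :=
  [set u | exists (n : nat) (a : 'I_n -> R) (p : 'I_n -> A),
     finite_partition fone p /\ u = \sum_(i < n) a i *: p i].

Definition localisable :=
  [/\ dedekind_sigma_complete A,
      sigma_order_continuous (@pos2 R A A) (@pos R A)
        (fun p => p.1 ** p.2) &
      forall u, pos u -> exists s : nat -> A,
        [/\ range s `<=` simple_elts `&` @pos R A, nondecreasing_seq s
          & supremums (range s) u]].

End f_algebra.

Section metric_notions.
Context (R : realType).

Record metric_riesz (V : rieszType R) (d : distance R V) : Prop := {
  mr_dedekind : dedekind_sigma_complete V ;
  mr_complete : complete_dist d ;
  mr_abs : forall u, d u 0 = d (rabs u) 0 ;
  mr_translate : forall u v w, d (u + w) (v + w) = d u v ;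
  mr_monotone : forall u v, 0 <= u -> u <= v -> d u 0 <= d v 0
}.

Record metric_falgebra (U : fAlgType R) (d : distance R U) : Prop := {
  mf_localisable : localisable U ;
  mf_riesz : metric_riesz d ;
  mf_mul : continuous
    ((fun p => p.1 ** p.2) : metr d * metr d -> metr d) ;
  mf_dense : dense (@simple_elts R U : set (metr d)) ;
  mf_one : d (e *: fone) 0 @[e --> 0^'+] --> 0
}.

End metric_notions.

(* A solid Riesz subspace (resp. f-subalgebra) of [A] is presented by its
   inclusion map, an injective morphism with solid image. *)
Section solid_subspaces.
Context (R : realType) (A : fAlgType R).

Definition solid_riesz_subspace (V : rieszType R) (j : {linear V -> A}) :=
  [/\ injective j,
      forall u v, j (u \join v) = j u \join j v,
      forall u v, j (u \meet v) = j u \meet j v &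
      forall (x : A) (u : V), rabs x <= rabs (j u) -> range j x].

Definition solid_f_subalgebra (U : fAlgType R) (i : {linear U -> A}) :=
  [/\ solid_riesz_subspace i, i fone = fone &
      forall u v, i (u ** v) = i u ** i v].

Definition prod_set (X Y : rieszType R) (jX : X -> A) (jY : Y -> A) : set A :=
  [set jX x ** jY y | x in [set: X] & y in [set: Y]].

(* the product [x ** y], computed in [A] and read in the subspace [T]; it has
   the junk value 0 when that product does not lie in [T] *)
Definition mul_in (X Y T : rieszType R)
    (jX : X -> A) (jY : Y -> A) (jT : T -> A) (x : X) (y : Y) : T :=
  xget 0 [set t | jT t = jX x ** jY y].

Record metric_f_structure (U : fAlgType R) (V : rieszType R)
    (i : {linear U -> A}) (dU : distance R U)
    (j : {linear V -> A}) (dV : distance R V) : Prop := {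
  ms_localisable : localisable A ;
  ms_U : metric_falgebra dU ;
  ms_U_solid : solid_f_subalgebra i ;
  ms_V : metric_riesz dV ;
  ms_V_solid : solid_riesz_subspace j ;
  ms_UV : prod_set i j = range j ;
  ms_mul : continuous
    ((fun p => mul_in i j j p.1 p.2) : metr dU * metr dV -> metr dV) ;
  ms_glue : forall (p : nat -> U) (e : R),
    countable_partition fone p -> 0 < e ->
    exists2 delta : R, 0 < delta & forall v : nat -> V,
      (forall n, 0 <= v n) ->
      (\sum_(0 <= n <oo) (dV (mul_in i j j (p n) (v n)) 0)%:E
         <= delta%:E)%E ->
      order_bounded (range (fun n => mul_in i j j (p n) (v n))) /\
      exists2 s, supremums (range (fun n => mul_in i j j (p n) (v n))) s
        & dV s 0 <= e
}.

Definition CR_metric_f_structure (U : fAlgType R) (V : rieszType R)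
    (i : {linear U -> A}) (dU : distance R U)
    (j : {linear V -> A}) (dV : distance R V) :=
  metric_f_structure i dU j dV /\
  [/\ countably_representable A, countably_representable U
    & countably_representable V].

Section dual_systems.
Context (U : fAlgType R) (V W Z : rieszType R).
Context (i : {linear U -> A}) (dU : distance R U).
Context (jV : {linear V -> A}) (dV : distance R V).
Context (jW : {linear W -> A}) (dW : distance R W).
Context (jZ : {linear Z -> A}) (dZ : distance R Z).

Record dual_system : Prop := {
  ds_V : metric_f_structure i dU jV dV ;
  ds_W : metric_f_structure i dU jW dW ;
  ds_Z : metric_f_structure i dU jZ dZ ;
  ds_VW : range jZ = prod_set jV jW ;
  ds_mul : continuous
    ((fun p => mul_in jV jW jZ p.1 p.2) : metr dV * metr dW -> metr dZ)
}.

Record complete_dual_system : Prop := {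
  cds_dual : dual_system ;
  cds_U : dedekind_complete U ;
  cds_V : dedekind_complete V ;
  cds_W : dedekind_complete W ;
  cds_Z : dedekind_complete Z ;
  cds_mulUV : order_continuous (@pos2 R U V) (@pos R V)
    (fun p => mul_in i jV jV p.1 p.2) ;
  cds_mulUW : order_continuous (@pos2 R U W) (@pos R W)
    (fun p => mul_in i jW jW p.1 p.2) ;
  cds_mulUZ : order_continuous (@pos2 R U Z) (@pos R Z)
    (fun p => mul_in i jZ jZ p.1 p.2) ;
  cds_mulVW : order_continuous (@pos2 R V W) (@pos R Z)
    (fun p => mul_in jV jW jZ p.1 p.2)
}.

Definition CR_dual_system :=
  [/\ complete_dual_system, CR_metric_f_structure i dU jV dV,
      CR_metric_f_structure i dU jW dW & CR_metric_f_structure i dU jZ dZ].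

End dual_systems.

Section normed_modules.
Context (U : fAlgType R) (V Z : rieszType R).
Context (i : {linear U -> A}) (j : {linear V -> A}) (jZ : {linear Z -> A}).
Context (dV : distance R V).
Context (M : lmodType (fring U)) (N : M -> V) (dM : distance R M).

Definition admissible (p : nat -> U) (v : nat -> M) :=
  countable_partition fone p /\
  order_bounded (range (fun n => N ((p n : fring U) *: v n))).

Definition glued_sum (p : nat -> U) (v : nat -> M) (w : M) :=
  forall n, (p n : fring U) *: w = (p n : fring U) *: v n.

Record normed_module : Prop := {
  nm_ge0 : forall v, 0 <= N v ;
  nm_eq0 : forall v, N v = 0 <-> v = 0 ;
  nm_triangle : forall v w, N (v + w) <= N v + N w ;
  nm_scale : forall (u : U) v,
    N ((u : fring U) *: v) = mul_in i j j (rabs u) (N v) ;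
  nm_glue : forall p v, admissible p v -> exists w, glued_sum p v w
}.

Definition module_dist := forall v w, dM v w = dV (N (v - w)) 0.

Definition banach_module :=
  [/\ normed_module, module_dist & complete_dist dM].

Definition glue_hull (S : set M) : set M :=
  [set w | exists (p : nat -> U) (v : nat -> M),
     [/\ range v `<=` S, admissible p v & glued_sum p v w]].

(* the square [|v|^2], an element of [Z] *)
Definition sqr_in (x : V) : Z := mul_in j j jZ x x.

Definition hilbert_module :=
  banach_module /\
  forall v w, sqr_in (N (v + w)) + sqr_in (N (v - w)) =
    2 *: sqr_in (N v) + 2 *: sqr_in (N w).

End normed_modules.

End solid_subspaces.

(* [module_dist] determines [dM]; the distance it asks for always exists. *)
Lemma module_dist_exists (R : realType) (A U : fAlgType R) (V : rieszType R)
    (i : {linear U -> A}) (j : {linear V -> A}) (dV : distance R V)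
    (M : lmodType (fring U)) (N : M -> V) :
  metric_riesz dV -> normed_module i j N ->
  exists dM : distance R M, module_dist dV N dM.
Proof.
move=> [_ _ _ dD dmono] [N0 Neq0 ND NZ _].
have rabsN (u : U) : rabs (- u) = rabs u.
  rewrite /rabs opprK; apply/eqP; rewrite eq_le !rjoin_le.
  by have := lexx (rjoin u (- u)); rewrite rjoin_le => /andP[-> ->];
     have := lexx (rjoin (- u) u); rewrite rjoin_le => /andP[-> ->].
have NN v : N (- v) = N v.
  by rewrite -scaleN1r -[in RHS](scale1r v) !NZ rabsN.
have dND v w u : dV (N (v - w)) 0 <= dV (N (v - u)) 0 + dV (N (u - w)) 0.
  have le1 : N (v - w) <= N (v - u) + N (u - w).
    by rewrite -[v in v - w](subrK u) -addrA; exact: ND.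
  apply: le_trans (dmono _ _ (N0 _) le1) _.
  apply: le_trans (dist_triangle dV (N (u - w)) _ _) _.
  by rewrite lerD2r -[X in dV _ X <= _]add0r dD.
unshelve eexists.
  apply: (@Distance R M (fun v w => dV (N (v - w)) 0)).
  - by move=> x; rewrite subrr (Neq0 0).2// distxx.
  - by move=> x y xy; apply/eqP; rewrite -subr_eq0; apply/eqP/(Neq0 _).1/(dist_positivity xy).
  - by move=> x y; rewrite -NN opprB.
  - by move=> y x z; exact: dND.
by [].
Qed.

(* convexity for the real vector space structure [t v := (t 1_U) v] *)
Definition module_convex (R : realType) (U : fAlgType R)
    (M : lmodType (fring U)) (C : set M) :=
  forall (v w : M) (t : R), C v -> C w -> 0 <= t <= 1 ->
    C ((t *: (fone : U) : fring U) *: v +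
       ((1 - t) *: (fone : U) : fring U) *: w).

(* Main.v *)
Require Import Defs.
From HB Require Import structures.
From mathcomp Require Import all_boot all_order all_algebra.
From mathcomp Require Import all_classical all_reals all_analysis.
From mathcomp Require Import ring lra.

(** Everything reduces to one estimate.  Put [h = |v - w_0|] for some [w_0] in
    [C], let [c] be the infimum of the [|v - w|] in [V], and call [w] in [C]
    [t]-minimising when [|v - w| <= c + t h].

    Such a [w] exists for every [t > 0] ([glue_near_inf]).  Countable
    representability gives a sequence [w_n] in [C] with [c = inf |v - w_n|].
    The set where [|v - w_n| <= c + t h] is encoded by an idempotent [e_n]
    ([support_idem]).  These idempotents cover [1]: on a part where all the
    inequalities fail, [c] could be raised by [t h], so [h] and then [|v - w_0|]
    vanish there, and the inequality for [w_0] holds after all.  Hence they can be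
    refined to a countable partition ([idem_disjointify]), along which the [w_n]
    glue to an element of [C].  The metric on [V] need not be order-continuous,
    so the sequence [w_n] itself could fail to converge; the glued elements do,
    because [t h] tends to [0] in distance with [t] ([near_scale]).

    The parallelogram identity and the convexity of [C] bound the square
    [|w - w'|^2] by [6 (s + t) h^2] when [w] is [s]-minimising and [w'] is
    [t]-minimising ([parallelogram_near_inf]).  Since the square of the distance
    of [H] is dominated by the distance of [Z] on squares, the minimisers form a
    Cauchy family as [t] tends to [0]; its limit is the projection.  The case
    [s = t = 0] of the same bound is uniqueness, and the formula for the
    distance follows because the projection attains both infima. *)

Set Implicit Arguments.
Unset Strict Implicit.
Unset Printing Implicit Defensive.

Import Order.TTheory GRing.Theory Num.Theory.
Import numFieldNormedType.Exports.

Local Open Scope classical_set_scope.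
Local Open Scope ring_scope.

(** * Order and lattice operations in Riesz spaces *)

Section RieszSpaces.
Context (R : realType) (V : rieszType R).
Implicit Types (a b : R) (t u v w x y : V).

Lemma rleD2r w u v : (u + w <= v + w) = (u <= v).
Proof.
apply/idP/idP; last exact: riesz_leD2r.
by move=> /(riesz_leD2r _ _ (- w)); rewrite !addrK.
Qed.

Lemma rleD2l w u v : (w + u <= w + v) = (u <= v).
Proof. by rewrite ![w + _]addrC rleD2r. Qed.

Lemma rleD u v x y : u <= v -> x <= y -> u + x <= v + y.
Proof.
by move=> uv xy; apply: (@le_trans _ _ (v + x)); rewrite ?rleD2r ?rleD2l.
Qed.

Lemma rleBlDr u v w : (u - v <= w) = (u <= w + v).
Proof. by rewrite -(rleD2r v (u - v)) subrK. Qed.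

Lemma rleBrDr u v w : (u <= v - w) = (u + w <= v).
Proof. by rewrite -(rleD2r w u) subrK. Qed.

Lemma rsub_ge0 u v : (0 <= v - u) = (u <= v).
Proof. by rewrite rleBrDr add0r. Qed.

Lemma raddr_ge0 u v : 0 <= u -> 0 <= v -> 0 <= u + v.
Proof. by move=> u0 v0; rewrite -[0]addr0 rleD. Qed.

Lemma rleN2 u v : (- u <= - v) = (v <= u).
Proof. by rewrite -(rsub_ge0 (- u)) opprK addrC rsub_ge0. Qed.

Lemma rle_scale a u v : 0 <= a -> u <= v -> a *: u <= a *: v.
Proof.
move=> a0 uv; rewrite -(rsub_ge0 (a *: u)) -scalerBr.
by rewrite riesz_scale_ge0 ?rsub_ge0.
Qed.

Lemma rle_scaler a b u : 0 <= u -> a <= b -> a *: u <= b *: u.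
Proof.
move=> u0 ab; rewrite -(rsub_ge0 (a *: u)) -scalerBl.
by rewrite riesz_scale_ge0 ?subr_ge0.
Qed.

Lemma rjoin_l u v : u <= u \join v.
Proof. by have := lexx (u \join v); rewrite rjoin_le => /andP[]. Qed.

Lemma rjoin_r u v : v <= u \join v.
Proof. by have := lexx (u \join v); rewrite rjoin_le => /andP[]. Qed.

Lemma rmeet_l u v : u \meet v <= u.
Proof. by have := lexx (u \meet v); rewrite le_rmeet => /andP[]. Qed.

Lemma rmeet_r u v : u \meet v <= v.
Proof. by have := lexx (u \meet v); rewrite le_rmeet => /andP[]. Qed.

Lemma rmeetC u v : u \meet v = v \meet u.
Proof. by apply/eqP; rewrite eq_le !le_rmeet !rmeet_l !rmeet_r. Qed.

Lemma rle_meetE u v : (u <= v) = (u \meet v == u).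
Proof.
apply/idP/eqP => [uv|<-]; last exact: rmeet_r.
by apply/eqP; rewrite eq_le rmeet_l le_rmeet lexx.
Qed.

Lemma rmeet_eq0 u v : 0 <= u -> 0 <= v -> u \meet v <= 0 -> u \meet v = 0.
Proof. by move=> u0 v0 uv; apply/eqP; rewrite eq_le uv le_rmeet u0. Qed.

(** Disjoint elements satisfy [u + v = u \join v]. *)
Lemma disjoint_add_le u v w : u \meet v = 0 -> u <= w -> v <= w -> u + v <= w.
Proof.
move=> uv uw vw.
have : u + v - w <= u \meet v.
  by rewrite le_rmeet !rleBlDr rleD2l vw addrC rleD2l.
by rewrite uv rleBlDr add0r.
Qed.

Lemma rpos_partE t : t \join 0 = (- t) \join 0 + t.
Proof.
apply/eqP; rewrite eq_le; apply/andP; split.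
  by rewrite rjoin_le -!rleBlDr subrr sub0r rjoin_r rjoin_l.
by rewrite -rleBrDr rjoin_le !rleBrDr addNr add0r rjoin_r rjoin_l.
Qed.

Lemma rpos_part_sub t : t = t \join 0 - ((- t) \join 0).
Proof. by rewrite (rpos_partE t) addrAC subrr add0r. Qed.

Lemma rpos_part_disjoint t : (t \join 0) \meet ((- t) \join 0) = 0.
Proof.
apply: rmeet_eq0; rewrite ?rjoin_r//.
set g := _ \meet _.
have : t \join 0 <= t \join 0 - g.
  rewrite rjoin_le rleBrDr [X in _ <= X]rpos_partE addrC rleD2r rmeet_r.
  by rewrite rsub_ge0 rmeet_l.
by rewrite rleBrDr -[X in _ <= X]addr0 rleD2l.
Qed.

Lemma rpos_part_eq0 t : t \join 0 = 0 -> t <= 0.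
Proof. by move=> <-; exact: rjoin_l. Qed.

Lemma rabs_ge0_id u : 0 <= u -> rabs u = u.
Proof.
move=> u0; apply/eqP; rewrite eq_le rjoin_l andbT rjoin_le lexx /=.
by rewrite (le_trans _ u0)// -[0]oppr0 rleN2.
Qed.

Lemma rabsN u : rabs (- u) = rabs u.
Proof. by apply/eqP; rewrite /rabs opprK eq_le !rjoin_le !rjoin_l !rjoin_r. Qed.

End RieszSpaces.

(** * Idempotents of f-algebras *)

Section FAlgebras.
Context (R : realType) (A : fAlgType R).
Implicit Types (a : R) (e f g p q r s t u v w x y : A).

Local Notation one := (fone : A).

Lemma fmul1r u : u ** one = u.
Proof. by rewrite fmulC fmul1. Qed.

Lemma fmulDr u v w : u ** (v + w) = u ** v + u ** w.
Proof. by rewrite !(fmulC u) fmulDl. Qed.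

Lemma fmul0l u : 0 ** u = 0.
Proof. by apply: (addIr (0 ** u)); rewrite -fmulDl !add0r. Qed.

Lemma fmul0r u : u ** 0 = 0.
Proof. by rewrite fmulC fmul0l. Qed.

Lemma fmulNl u v : (- u) ** v = - (u ** v).
Proof. by apply/eqP; rewrite -addr_eq0 -fmulDl addNr fmul0l. Qed.

Lemma fmulNr u v : u ** (- v) = - (u ** v).
Proof. by rewrite fmulC fmulNl fmulC. Qed.

Lemma fmulBl u v w : (u - v) ** w = u ** w - v ** w.
Proof. by rewrite fmulDl fmulNl. Qed.

Lemma fmulBr u v w : u ** (v - w) = u ** v - u ** w.
Proof. by rewrite fmulDr fmulNr. Qed.

Lemma fscaleAr a u v : a *: (u ** v) = u ** (a *: v).
Proof. by rewrite fmulC fscaleAl fmulC. Qed.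

Lemma fmul_le2l w u v : 0 <= w -> u <= v -> w ** u <= w ** v.
Proof.
by move=> w0 uv; rewrite -(rsub_ge0 (w ** u)) -fmulBr fmul_ge0// rsub_ge0.
Qed.

Lemma fmul_le2r w u v : 0 <= w -> u <= v -> u ** w <= v ** w.
Proof. by move=> w0 uv; rewrite !(fmulC _ w) fmul_le2l. Qed.

(** Multiplying each factor of a disjoint pair by the other keeps the pair
    disjoint, so [u ** v] is disjoint from itself. *)
Lemma disjoint_fmul u v : u \meet v = 0 -> u ** v = 0.
Proof.
move=> uv; have [u0 v0] : 0 <= u /\ 0 <= v.
  by rewrite -uv; split; [exact: rmeet_l|exact: rmeet_r].
have := fmul_meet _ _ v uv v0; rewrite rmeetC => /(fmul_meet _ _ u)/(_ u0).
rewrite (fmulC v) => <-.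
by apply/eqP; rewrite eq_le rmeet_l le_rmeet lexx.
Qed.

(** The cross terms of [u^+ - u^-] vanish, since the two parts are disjoint. *)
Lemma fsqr_ge0 u : 0 <= u ** u.
Proof.
have d := disjoint_fmul (rpos_part_disjoint u).
rewrite [u]rpos_part_sub fmulBr !fmulBl d (fmulC _ (u \join 0)) d.
rewrite subr0 sub0r opprK.
by apply: raddr_ge0; apply: fmul_ge0; exact: rjoin_r.
Qed.

Lemma fone_ge0 : 0 <= one.
Proof. by rewrite -[one]fmul1 fsqr_ge0. Qed.

Lemma idem_ge0 e : idem e -> 0 <= e.
Proof. by move=> /= <-; exact: fsqr_ge0. Qed.

Lemma idem_compl_mul e : idem e -> (one - e) ** e = 0.
Proof. by move=> /= ee; rewrite fmulBl fmul1 ee subrr. Qed.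

Lemma idem_compl e : idem e -> idem (one - e).
Proof.
by move=> ee; rewrite /idem /= fmulBr fmul1r idem_compl_mul// subr0.
Qed.

Lemma idem_le1 e : idem e -> e <= one.
Proof. by move=> /idem_compl/idem_ge0; rewrite rsub_ge0. Qed.

Lemma idem_mul e f : idem e -> idem f -> idem (e ** f).
Proof.
rewrite /idem /= => ee ff.
by rewrite -!fmulA (fmulA f) (fmulC f e) -fmulA ff fmulA ee.
Qed.

Lemma fmul_le_l u v : 0 <= u -> 0 <= v -> v <= one -> u ** v <= u.
Proof. by move=> u0 v0 v1; rewrite -[leRHS]fmul1r fmul_le2l. Qed.

(** Splitting along [e] and [fone - e]: the meet is at most [t] on the first part
    and at most [e] on the second, and both bounds are [0] there. *)
Lemma idem_disjoint e t : idem e -> 0 <= t -> e ** t = 0 -> e \meet t = 0.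
Proof.
move=> ee t0 et; have e0 := idem_ge0 ee.
apply: rmeet_eq0 => //; set g := _ \meet _.
have -> : g = e ** g + (one - e) ** g by rewrite -fmulDl addrC subrK fmul1.
rewrite -[0]addr0; apply: rleD; first by rewrite -et fmul_le2l ?rmeet_r.
rewrite -(idem_compl_mul ee) fmul_le2l ?rmeet_l//.
exact/idem_ge0/idem_compl.
Qed.

Lemma one_disjoint t : one \meet t = 0 -> t = 0.
Proof. by move=> /disjoint_fmul; rewrite fmul1. Qed.

(** The parts [e ** t^+ <= e ** t^-] are disjoint, so the smaller is [0]. *)
Lemma idem_pos_part_eq0 e t : idem e -> e ** t <= 0 -> e ** (t \join 0) = 0.
Proof.
move=> ee et.
have e0 := idem_ge0 ee; have le : e ** (t \join 0) <= e ** ((- t) \join 0).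
  by rewrite rpos_partE fmulDr -[X in _ <= X]addr0 rleD2l.
have := fmul_meet _ _ e (rpos_part_disjoint t) e0.
rewrite rmeetC => /(fmul_meet _ _ e)/(_ e0).
rewrite rmeetC ![_ ** e]fmulC => d.
by apply/eqP; rewrite -[X in _ == X]d eq_sym -rle_meetE.
Qed.

(** The idempotent [e] plays the role of the indicator of the set where [f] is
    positive; it is the supremum of the truncations [n f /\ 1].  Each claim
    about [e] holds because an element smaller than [e] would otherwise still
    bound all the truncations. *)
Lemma support_idem (f : A) : dedekind_sigma_complete A -> 0 <= f ->
  exists e, [/\ idem e, f ** (one - e) = 0 &
    forall t, 0 <= t -> f ** t = 0 -> e ** t = 0].
Proof.
move=> [supA _] f0.
pose F n := (f *+ n) \meet one.
have [|||e [/= eub elub]] := supA (range F).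
- exact: card_image_le.
- by exists (F 0%N), 0%N.
- by exists one => _ [n _ <-]; exact: rmeet_r.
have Fe n : F n <= e by apply: eub; exists n.
have le_e s : (forall n, F n <= s) -> e <= s.
  by move=> Fs; apply: elub => _ [n _ <-].
have fn0 n : 0 <= f *+ n.
  by elim: n => [|n IH]; rewrite ?mulr0n// mulrS raddr_ge0.
have F0 n : 0 <= F n by rewrite le_rmeet fn0 fone_ge0.
have e0 : 0 <= e := le_trans (F0 0%N) (Fe 0%N).
have e1 : e <= one by apply: le_e => n; exact: rmeet_r.
have fe : f ** (one - e) = 0.
  apply: disjoint_fmul; apply: rmeet_eq0; rewrite ?rsub_ge0//.
  set g := _ \meet _.
  suff : e <= e - g by rewrite rleBrDr -[X in _ <= X]addr0 rleD2l.
  apply: le_e => n; rewrite rleBrDr; apply: le_trans (Fe n.+1).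
  rewrite le_rmeet mulrSr rleD ?rmeet_l//=.
  by rewrite addrC -rleBrDr (le_trans (rmeet_r _ _))// rleD2l rleN2.
have Fmul t n : 0 <= t -> f ** t = 0 -> F n ** t = 0.
  move=> t0 ft; apply/eqP; rewrite eq_le fmul_ge0// andbT.
  apply: le_trans (fmul_le2r t0 (rmeet_l _ _)) _.
  elim: n => [|n]; rewrite ?mulr0n ?fmul0l//.
  by rewrite mulrS fmulDl ft add0r.
(* [n f /\ 1] is annihilated by [t], hence it stays below [e ** (fone - t)]. *)
have et1 t : 0 <= t -> t <= one -> f ** t = 0 -> e ** t = 0.
  move=> t0 t1 ft; apply/eqP; rewrite eq_le fmul_ge0// andbT.
  suff : e <= e - e ** t by rewrite rleBrDr -[X in _ <= X]addr0 rleD2l.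
  apply: le_e => n; rewrite -[X in X <= _]subr0 -(Fmul t n)//.
  rewrite -[X in X - _]fmul1r -[X in _ <= X - _]fmul1r -!fmulBr.
  by rewrite fmul_le2r ?rsub_ge0.
have ee : idem e.
  rewrite /idem /=; apply/eqP; rewrite eq_le fmul_le_l//=.
  apply: le_e => n.
  have /eqP : F n ** (one - e) = 0 by apply: Fmul; rewrite ?rsub_ge0.
  rewrite fmulBr fmul1r subr_eq0 => /eqP->.
  by apply: fmul_le2r.
(* A general [t] is truncated to [e /\ t]. *)
exists e; split=> // t t0 ft.
apply: disjoint_fmul; apply: rmeet_eq0 => //.
have m0 : 0 <= e \meet t by rewrite le_rmeet e0.
have fm : f ** (e \meet t) = 0.
  by apply/eqP; rewrite eq_le fmul_ge0// andbT -ft fmul_le2l ?rmeet_r.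
have := et1 _ m0 (le_trans (rmeet_l _ _) e1) fm.
move=> em; have := idem_disjoint ee m0 em => <-.
by rewrite le_rmeet rmeet_l lexx.
Qed.

(** The part [p n] of [e n] is what the earlier idempotents leave uncovered.
    Leastness of the upper bound [fone] is where the covering hypothesis enters:
    for another bound [s], the positive part of [fone - s] avoids every [e n]. *)
Lemma idem_disjointify (e : nat -> A) : (forall n, idem (e n)) ->
  (forall r, 0 <= r -> r <= one -> (forall n, r ** e n = 0) -> r = 0) ->
  exists p : nat -> A, countable_partition one p /\ forall n, p n ** e n = p n.
Proof.
move=> ee ecover.
(* [q n] is the part of [fone] that avoids [e m] for all [m < n]. *)
pose q := fix q n := if n is m.+1 then q m ** (one - e m) else one.
pose p n := q n ** e n.
have qi n : idem (q n).
  elim: n => [|n IH]; first by rewrite /idem /= fmul1.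
  exact: idem_mul IH (idem_compl (ee n)).
have q0 n := idem_ge0 (qi n).
have pi n : idem (p n) by exact: idem_mul.
have p0 n := idem_ge0 (pi n).
have qS n : q n.+1 = q n - p n by rewrite /= fmulBr fmul1r.
have qe m n : (m < n)%N -> q n ** e m = 0.
  elim: n => // n IH; rewrite ltnS leq_eqVlt => /orP[/eqP->|/IH qe] /=.
    by rewrite -fmulA idem_compl_mul// fmul0r.
  by rewrite fmulC fmulA (fmulC (e m)) qe fmul0l.
have pp m n : (m < n)%N -> p m ** p n = 0.
  by move=> mn; rewrite /p -fmulA (fmulA (e m)) (fmulC (e m)) qe// fmul0l fmul0r.
exists p; split; last by move=> n; rewrite /p -fmulA ee.
split=> //.
  move=> m n mn; rewrite !rabs_ge0_id//; apply: idem_disjoint => //.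
  by have [/pp//|/pp|//] := ltngtP m n; rewrite fmulC.
split; first by move=> _ [n _ <-]; exact: idem_le1.
move=> s ps; have {}ps n : p n <= s by apply: ps; exists n.
have qs n : one - q n <= s.
  elim: n => [|n IH]; first by rewrite subrr (le_trans (p0 0%N)).
  rewrite qS opprB addrCA; apply: disjoint_add_le => //.
  apply: idem_disjoint => //; first by rewrite rsub_ge0 idem_le1.
  by rewrite /p fmulC fmulA idem_compl_mul// fmul0l.
rewrite -(rsub_ge0 one) -rleN2 oppr0 opprB; apply: rpos_part_eq0.
have rq n : (one - s) \join 0 <= q n.
  by rewrite rjoin_le q0 andbT rleBlDr addrC -rleBlDr.
apply: ecover; rewrite ?rjoin_r//; first exact: rq 0%N.
move=> n; apply/eqP; rewrite eq_le fmul_ge0 ?rjoin_r ?idem_ge0// andbT.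
apply: le_trans (fmul_le2r (idem_ge0 (ee n)) (rq n.+1)) _.
by rewrite (qe n n.+1).
Qed.

End FAlgebras.

(** * Solid subspaces and partitions of unity *)

Section SolidSubspaces.
Context (R : realType) (A : fAlgType R) (V : rieszType R) (j : {linear V -> A}).
Context (hj : solid_riesz_subspace j).

Lemma solid_le (x y : V) : (j x <= j y) = (x <= y).
Proof.
have [inj _ jm _] := hj.
by rewrite !rle_meetE -jm (inj_eq inj).
Qed.

Lemma solid_ge0 (x : V) : (0 <= j x) = (0 <= x).
Proof. by rewrite -solid_le raddf0. Qed.

Lemma solid_surj (a : A) (x : V) : 0 <= a -> a <= j x -> exists y, j y = a.
Proof.
move=> a0 ax; have [_ _ _ /(_ a x)] := hj.
rewrite !rabs_ge0_id ?(le_trans a0)// => /(_ ax)[y _ <-].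
by exists y.
Qed.

End SolidSubspaces.

(** The junk value of [mul_in] never occurs when the products fill [T]. *)
Lemma mul_inE (R : realType) (A : fAlgType R) (X Y T : rieszType R)
    (jX : X -> A) (jY : Y -> A) (jT : T -> A) (x : X) (y : Y) :
  prod_set jX jY = range jT -> jT (mul_in jX jY jT x y) = jX x ** jY y.
Proof.
move=> XY; have [t _ tE] : range jT (jX x ** jY y).
  by rewrite -XY; exists x => //; exists y.
by rewrite /mul_in; case: xgetP => [z _ //|/(_ t) /=]; rewrite tE.
Qed.

Section Partitions.
Context (R : realType) (A U : fAlgType R) (i : {linear U -> A}).
Context (hi : solid_f_subalgebra i).

Let his : solid_riesz_subspace i. Proof. by case: hi. Qed.
Let i1 : i fone = fone. Proof. by case: hi. Qed.
Let iM u v : i (u ** v) = i u ** i v. Proof. by case: hi. Qed.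

Lemma idem_embed (e : U) : idem (i e) <-> idem e.
Proof.
have [inj _ _ _] := his.
by rewrite /idem /= -iM; split=> [/inj//|->].
Qed.

(** Idempotents lie between [0] and [1], so solidity puts them all in [U]. *)
Lemma idem_lift (e : A) : idem e -> exists u, i u = e.
Proof.
move=> ee; apply: (@solid_surj _ _ _ _ his e fone); first exact: idem_ge0.
by rewrite i1 idem_le1.
Qed.

(** The supremum [fone] of the partition is computed in [U], while [t] lives in
    the larger algebra; truncating [t] at [1] brings it down to [U]. *)
Lemma partition_eq0 (p : nat -> U) (t : A) : countable_partition fone p ->
  0 <= t -> (forall n, i (p n) ** t = 0) -> t = 0.
Proof.
move=> [pp _ [_ plub]] t0 pt; apply: one_disjoint.
set t1 := _ \meet _.
have t10 : 0 <= t1 by rewrite le_rmeet fone_ge0.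
have [|u uE] := @solid_surj _ _ _ _ his t1 fone t10.
  by rewrite i1 rmeet_l.
have : fone <= fone - u.
  apply: plub => _ [n _ <-]; rewrite -(solid_le his) raddfB /= i1 uE rleBrDr.
  have pn := (idem_embed (p n)).2 (pp n); have pn0 := idem_ge0 pn.
  apply: disjoint_add_le; rewrite ?rmeet_l ?idem_le1//.
  apply: idem_disjoint => //; apply/eqP; rewrite eq_le fmul_ge0// andbT.
  by rewrite -(pt n) fmul_le2l ?rmeet_r.
rewrite rleBrDr -[X in _ <= X]addr0 rleD2l -(solid_le his) uE raddf0 => t1le.
by apply/eqP; rewrite eq_le t1le.
Qed.

Lemma partition_le (p : nat -> U) (x y : A) : countable_partition fone p ->
  (forall n, i (p n) ** x <= i (p n) ** y) -> x <= y.
Proof.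
move=> pP xy; rewrite -[X in _ <= X]add0r -rleBlDr; apply: rpos_part_eq0.
apply: (partition_eq0 pP); first exact: rjoin_r.
move=> n; apply: idem_pos_part_eq0.
  by apply/idem_embed; case: pP.
by rewrite fmulBr rleBlDr add0r.
Qed.

End Partitions.

(** * Near-minimisers by glueing *)

Section NormedModules.
Context (R : realType) (A U : fAlgType R) (V : rieszType R).
Context (i : {linear U -> A}) (j : {linear V -> A}).
Context (H : lmodType (fring U)) (N : H -> V).
Context (hA : dedekind_sigma_complete A).
Context (hi : solid_f_subalgebra i).
Context (hj : solid_riesz_subspace j).
Context (hUV : prod_set i j = range j).
Context (hN : normed_module i j N).

Let his : solid_riesz_subspace i. Proof. by case: hi. Qed.
Let i1 : i fone = fone. Proof. by case: hi. Qed.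
Let iM u v : i (u ** v) = i u ** i v. Proof. by case: hi. Qed.

Lemma norm_scaleE (u : U) (z : H) :
  j (N ((u : fring U) *: z)) = i (rabs u) ** j (N z).
Proof. by rewrite (nm_scale hN) mul_inE. Qed.

Lemma norm_scale_ge0 (u : U) (z : H) : 0 <= u ->
  j (N ((u : fring U) *: z)) = i u ** j (N z).
Proof. by move=> u0; rewrite norm_scaleE rabs_ge0_id. Qed.

Lemma normN (z : H) : N (- z) = N z.
Proof.
have [inj _ _ _] := hj; apply: inj.
rewrite -scaleN1r -[in RHS](scale1r z).
by rewrite !(norm_scaleE (_ : fring U)) rabsN.
Qed.

Lemma normBC (x y : H) : N (x - y) = N (y - x).
Proof. by rewrite -normN opprB. Qed.

(** Dini's theorem up to a partition: the infimum is approached within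
    [e *: N (v - w 0)] by a single glued element.  The error must be relative to
    [N (v - w 0)], as [V] need not contain a unit; this also makes the sets where
    [w n] is good enough cover everything. *)
Lemma glue_near_inf (C : set H) (v : H) (w : nat -> H) (c : V) (e : R) :
  glue_hull N C `<=` C -> (forall n, C (w n)) ->
  infimums (range (fun n => N (v - w n))) c -> 0 < e ->
  exists2 w', C w' & N (v - w') <= c + e *: N (v - w 0%N).
Proof.
move=> Cglue Cw [clb cglb] e0; set h := N (v - w 0%N).
have cx n : c <= N (v - w n) by apply: clb; exists n.
have h0 : 0 <= h := nm_ge0 hN _.
have c0 : 0 <= c by apply: cglb => _ [n _ <-]; exact: nm_ge0 hN _.
pose y := j (c + e *: h); pose x n := j (N (v - w n)).
have x0 n : 0 <= x n by rewrite (solid_ge0 hj) (nm_ge0 hN).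
have y0 : 0 <= y.
  by rewrite (solid_ge0 hj) raddr_ge0 ?riesz_scale_ge0// ltW.
(* [F n] is the set where [w n] is too far from [v], [E n] its complement. *)
have /choice[F FP] := fun n => support_idem hA (rjoin_r (x n - y) 0).
have /choice[E EF] : forall n, exists u, i u = fone - F n.
  by move=> n; apply: (idem_lift hi); apply: idem_compl; case: (FP n).
have Ei n : idem (E n).
  by apply/(idem_embed hi); rewrite EF; apply: idem_compl; case: (FP n).
have Ele n : i (E n) ** x n <= i (E n) ** y.
  rewrite -[X in _ <= X]add0r -rleBlDr -fmulBr EF [x n - y]rpos_part_sub fmulBr.
  have [Fi fF _] := FP n; rewrite (fmulC _ (_ \join 0)) fF sub0r.
  rewrite -[X in _ <= X]oppr0 rleN2 fmul_ge0 ?rjoin_r//.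
  by apply/idem_ge0/idem_compl.
(* Covering: let [r] avoid every [E n], that is, every [w n] is bad on [r]. *)
have [|p [pP pE]] := idem_disjointify Ei.
  move=> r r0 r1 rE; have [inj _ _ _] := his; apply: inj; rewrite raddf0.
  have ir0 : 0 <= i r by rewrite (solid_ge0 his).
  have ir1 : i r <= fone by rewrite -i1 (solid_le his).
  have rF n : i r ** F n = i r.
    have := congr1 i (rE n); rewrite iM EF raddf0 fmulBr fmul1r => /eqP.
    by rewrite subr_eq0 => /eqP.
  have ryx n : i r ** y <= i r ** x n.
    rewrite -(rsub_ge0 (i r ** y)) -fmulBr -(rF n) -fmulA.
    have [Fi _ Fd] := FP n; rewrite [x n - y]rpos_part_sub fmulBr.
    rewrite (Fd _ (rjoin_r _ _) (disjoint_fmul (rpos_part_disjoint _))) subr0.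
    by rewrite fmul_ge0// fmul_ge0 ?rjoin_r// idem_ge0.
  pose k := mul_in i j j r h.
  have jk : j k = i r ** j h by rewrite /k mul_inE.
  (* [c] could be raised by [e *: k], as the infimum is taken in [V]. *)
  have : c + e *: k <= c.
    apply: cglb => _ [n _ <-]; rewrite -(solid_le hj) raddfD /= linearZ /= jk.
    have cr : (fone - i r) ** j c <= (fone - i r) ** x n.
      by rewrite fmul_le2l ?rsub_ge0// /x (solid_le hj).
    have := rleD (ryx n) cr; rewrite -fmulDl [i r + _]addrC subrK fmul1.
    rewrite /y raddfD /= linearZ /= fmulDr -fscaleAr addrAC -fmulDl.
    by rewrite [i r + _]addrC subrK fmul1.
  rewrite -[X in _ <= X]addr0 rleD2l => ek0.
  have {ek0} jk0 : i r ** j h = 0.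
    apply/eqP; rewrite eq_le fmul_ge0 ?(solid_ge0 hj)// andbT -jk.
    have := rle_scale (ltW (_ : 0 < e^-1)) ek0.
    rewrite invr_gt0 => /(_ e0); rewrite scalerA mulVf ?gt_eqF// scale1r scaler0.
    by rewrite -(solid_le hj) raddf0.
  (* So [h] vanishes on [r], and [w 0] is good there: [r] is [0]. *)
  rewrite -(rF 0%N); have [Fi _ Fd] := FP 0%N.
  rewrite fmulC; apply: Fd => //; apply/eqP.
  rewrite eq_le fmul_ge0 ?rjoin_r// andbT -[X in _ <= X]jk0 fmulC fmul_le2l//.
  by rewrite rjoin_le (solid_ge0 hj) h0 andbT rleBlDr -[X in X <= _]addr0 rleD2l.
have pi n : idem (p n) by case: pP.
have p0 n : 0 <= p n := idem_ge0 (pi n).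
have ip0 n : 0 <= i (p n) by rewrite (solid_ge0 his).
have ple n : i (p n) ** x n <= i (p n) ** y.
  by rewrite -(pE n) iM -!fmulA fmul_le2l.
have adm : admissible N p w.
  split=> //; split; first by exists 0 => _ [n _ <-]; exact: nm_ge0 hN _.
  exists (N v + (c + e *: h)) => _ [n _ <-].
  rewrite -(solid_le hj) raddfD /= norm_scale_ge0//.
  have wn : j (N (w n)) <= j (N v) + x n.
    rewrite /x -raddfD /= (solid_le hj) -(normN (v - w n)).
    by rewrite (le_trans _ (nm_triangle hN _ _))// opprB addrC subrK.
  apply: le_trans (fmul_le2l (ip0 n) wn) _; rewrite fmulDr.
  have ip1 : i (p n) <= fone by rewrite idem_le1//; apply/(idem_embed hi).
  apply: rleD; first by rewrite fmulC fmul_le_l ?(solid_ge0 hj) ?(nm_ge0 hN).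
  by rewrite (le_trans (ple n))// fmulC fmul_le_l.
have [w' w'E] := nm_glue hN adm.
exists w'; first by apply: Cglue; exists p, w; split=> // _ [n _ <-].
rewrite -(solid_le hj); apply: (partition_le hi pP) => n.
rewrite -(norm_scale_ge0 _ (p0 n)) scalerBr w'E -scalerBr norm_scale_ge0//.
Qed.

End NormedModules.
(** * The Cauchy estimate *)

(** The midpoint [m] of [w] and [w'] lies in [C], so the parallelogram identity
    gives [|w - w'|^2 <= 2 |v - w|^2 + 2 |v - w'|^2 - 4 c^2], and
    [(c + r h)^2 <= c^2 + 3 r h^2] as [c <= h] and [r <= 1]. *)
Lemma parallelogram_near_inf (R : realType) (A U : fAlgType R)
    (V Z : rieszType R) (i : {linear U -> A}) (j : {linear V -> A})
    (jZ : {linear Z -> A}) (H : lmodType (fring U)) (N : H -> V)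
    (C : set H) (v w w' : H) (c h : V) (s t : R) :
  solid_f_subalgebra i -> solid_riesz_subspace j -> solid_riesz_subspace jZ ->
  prod_set i j = range j -> prod_set j j = range jZ -> normed_module i j N ->
  (forall a b : H, sqr_in j jZ (N (a + b)) + sqr_in j jZ (N (a - b)) =
    2 *: sqr_in j jZ (N a) + 2 *: sqr_in j jZ (N b)) ->
  module_convex C -> (forall u, C u -> c <= N (v - u)) ->
  0 <= c -> c <= h -> 0 <= s <= 1 -> 0 <= t <= 1 -> C w -> C w' ->
  N (v - w) <= c + s *: h -> N (v - w') <= c + t *: h ->
  sqr_in j jZ (N (w - w')) <= (s + t) *: (6 *: sqr_in j jZ h).
Proof.
move=> hi hj hjZ hij hjj hN hpar Ccvx cC c0 ch s01 t01 Cw Cw' ws wt.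
have sqrE x : jZ (sqr_in j jZ x) = j x ** j x by rewrite mul_inE.
have sqr_le x y : 0 <= x -> x <= y -> sqr_in j jZ x <= sqr_in j jZ y.
  move=> x0 xy; rewrite -(solid_le hjZ) !sqrE.
  have jx0 : 0 <= j x by rewrite (solid_ge0 hj).
  have jxy : j x <= j y by rewrite (solid_le hj).
  by apply: le_trans (fmul_le2l jx0 jxy) (fmul_le2r (le_trans jx0 jxy) jxy).
have sqr_near r : 0 <= r <= 1 ->
    sqr_in j jZ (c + r *: h) <= sqr_in j jZ c + (3 * r) *: sqr_in j jZ h.
  move=> /andP[r0 r1]; rewrite -(solid_le hjZ) raddfD /= linearZ /= !sqrE.
  rewrite raddfD /= linearZ /= fmulDl fmulDr fmulDr -addrA rleD2l.
  have jc0 : 0 <= j c by rewrite (solid_ge0 hj).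
  have jh0 : 0 <= j h by rewrite (solid_ge0 hj) (le_trans c0).
  have jch : j c <= j h by rewrite (solid_le hj).
  have chh : j c ** j h <= j h ** j h by exact: fmul_le2r.
  have -> : 3 * r = r + (r + r) by ring.
  rewrite -fscaleAl -fscaleAl -!fscaleAr (fmulC (j h)) !scalerDl.
  apply: rleD; first exact: rle_scale.
  apply: rleD; first exact: rle_scale.
  rewrite scalerA; apply: rle_scaler; first exact: fmul_ge0.
  by rewrite -[leRHS]mulr1 ler_wpM2l.
pose m := ((2^-1 *: (fone : U) : fring U) *: w +
  ((1 - 2^-1) *: (fone : U) : fring U) *: w').
have Cm : C m by apply: Ccvx => //; lra.
have two_ge0 : 0 <= 2 *: (fone : U) by rewrite riesz_scale_ge0 ?fone_ge0.
have mE : (v - w) + (v - w') = ((2 *: (fone : U)) : fring U) *: (v - m).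
  have half : ((2 *: (fone : U)) : fring U) * (2^-1 *: (fone : U)) = 1.
    rewrite [LHS](_ : _ = (2 *: (fone : U)) ** (2^-1 *: (fone : U)))//.
    by rewrite -fscaleAl fmul1 scalerA mulfV ?pnatr_eq0// scale1r.
  have half' : 1 - 2^-1 = 2^-1 :> R by lra.
  have two : ((2 *: (fone : U)) : fring U) = 1 + 1 by exact: scaler_nat.
  rewrite scalerBr /m half' scalerDr !scalerA half !scale1r two scalerDl scale1r.
  by rewrite opprD addrACA.
have sumE : 4 *: sqr_in j jZ c <= sqr_in j jZ (N ((v - w) + (v - w'))).
  have [_ i1 _] := hi.
  rewrite mE -(solid_le hjZ) linearZ /= !sqrE (norm_scale_ge0 hij hN _ two_ge0).
  rewrite linearZ /= i1 -fscaleAl fmul1 -fscaleAl -fscaleAr scalerA.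
  have -> : 2 * 2 = 4 :> R by ring.
  rewrite rle_scale// -!sqrE (solid_le hjZ); apply: sqr_le => //.
  exact: cC.
have := hpar (v - w) (v - w').
have -> : N (v - w - (v - w')) = N (w - w').
  by rewrite -(normN hj hij hN) opprB opprB addrC addrA subrK.
move=> /eqP; rewrite addrC eq_sym -subr_eq eq_sym => /eqP->.
rewrite rleBlDr; apply: le_trans (rleD (lexx _) sumE).
have bnd r a : 0 <= r <= 1 -> N a <= c + r *: h -> 2 *: sqr_in j jZ (N a) <=
    r *: (6 *: sqr_in j jZ h) + 2 *: sqr_in j jZ c.
  move=> r01 ar.
  apply: le_trans (rle_scale _ (sqr_le _ _ (nm_ge0 hN _) ar)) _ => //.
  apply: le_trans (rle_scale _ (sqr_near _ r01)) _ => //.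
  rewrite scalerDr addrC !scalerA rleD2r.
  by have -> : 2 * (3 * r) = r * 6 by ring.
apply: le_trans (rleD (bnd _ _ s01 ws) (bnd _ _ t01 wt)) _.
rewrite addrACA -scalerDl -scalerDl.
by have -> : 2 + 2 = 4 :> R by ring.
Qed.

(** * Translation-invariant distances *)

Section Distances.
Context (R : realType).

(** Scaling by [t] is multiplication by [t *: fone], which tends to [0] in [U];
    continuity of the product does the rest. *)
Lemma near_scale (A U : fAlgType R) (V : rieszType R) (i : {linear U -> A})
    (dU : distance R U) (j : {linear V -> A}) (dV : distance R V) (x : V) e :
  metric_f_structure i dU j dV -> 0 < e ->
  \forall t \near 0^'+, dV (t *: x) 0 < e.
Proof.
move=> hS e0.
have [inj _ _ _] := ms_V_solid hS; have [_ i1 _] := ms_U_solid hS.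
have mulE := mul_inE _ _ (ms_UV hS).
pose z : metr dU * metr dV := (0 : U, x).
pose f (t : R) : metr dU * metr dV := (t *: (fone : U), x).
have cf : f t @[t --> 0^'+] --> z.
  apply: (@cvg_pair _ _ _ _ (nbhs ((0 : U) : metr dU)) (nbhs (x : metr dV)));
    last exact: cvg_cst.
  apply/metricType_numDomainType.cvgrPdist_lt => d d0.
  have /cvgrPdist_lt/(_ d d0) := mf_one (ms_U hS).
  apply: filterS => t; rewrite sub0r normrN /mdist/= (dist_sym dU).
  by apply: le_lt_trans; exact: ler_norm.
pose g (y : metr dU * metr dV) : metr dV := mul_in i j j y.1 y.2.
have cg : g y @[y --> z] --> g z by exact: (ms_mul hS).
have := cvg_comp _ _ cf cg.
move=> /metricType_numDomainType.cvgrPdist_lt/(_ e e0); apply: filterS => t /=.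
rewrite /mdist /= (dist_sym dV).
congr (dV _ _ < _); apply: inj; rewrite mulE /=.
  by rewrite linearZ /= i1 linearZ /= -fscaleAl fmul1.
by rewrite !raddf0 fmul0l.
Qed.

Lemma dist_add0 (V : rieszType R) (dV : distance R V) (x y : V) :
  metric_riesz dV -> dV (x + y) 0 <= dV x 0 + dV y 0.
Proof.
move=> dR; apply: le_trans (dist_triangle dV y _ _) _.
by rewrite -{2}[y]add0r (mr_translate dR).
Qed.

Lemma distB0 (V : rieszType R) (dV : distance R V) (x y : V) :
  metric_riesz dV -> dV (x - y) 0 = dV x y.
Proof. by move=> dR; rewrite -(mr_translate dR _ _ y) subrK add0r. Qed.

Lemma dist_ge0 (T : Type) (d : distance R T) x y : 0 <= d x y.
Proof.
have := dist_triangle d y x x; rewrite distxx (dist_sym d y x) => ?.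
lra.
Qed.

End Distances.

(** * Projection onto a closed convex set *)

Theorem theorem3p36 (R : realType) (A U : fAlgType R) (V Z : rieszType R)
    (i : {linear U -> A}) (dU : distance R U)
    (j : {linear V -> A}) (dV : distance R V)
    (jZ : {linear Z -> A}) (dZ : distance R Z)
    (hS : CR_dual_system i dU j dV j dV jZ dZ)
    (H : lmodType (fring U)) (N : H -> V) (dH : distance R H)
    (hH : hilbert_module i j jZ dV N dH)
    (hd : forall v : H, dH v 0 ^+ 2 <= dZ (sqr_in j jZ (N v)) 0)
    (C : set H) (C0 : C !=set0)
    (Cclosed : closed (C : set (metr dH))) (Cconvex : module_convex C)
    (Cglue : glue_hull N C = C) (v : H) :
  exists vC : V,
    [/\ infimums [set N (v - w) | w in C] vC,
        0 <= vC,
        dV vC 0 = inf [set dH v w | w in C] &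
        exists! p : H, C p /\ vC = N (v - p)].
Proof.
have [[[_ _ _ hVW _] _ _ _ _ _ _ _ _] [mV [_ _ crV]] _ [mZ _]] := hS.
have [[hN dHE Hcomplete] hpar] := hH.
have [[hA _ _] _ hi dVr hj hUV _ _] := mV.
have hjZ := ms_V_solid mZ; have dZr := ms_V mZ.
pose S := [set N (v - w) | w in C].
have S0 : S !=set0 by have [w Cw] := C0; exists (N (v - w)), w.
have Slb : has_lbound S by exists 0 => _ [w _ <-]; exact: nm_ge0 hN _.
have [[_ infV] _ crinf] := crV.
have [c cS] := infV S S0 Slb; have [clb cglb] := cS.
have [s [sS sE]] := crinf S S0 Slb.
have /choice[w wE] : forall n, exists w, C w /\ N (v - w) = s n.
  by move=> n; have [|w Cw wE] := sS (s n); [exists n|exists w].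
have Cw n : C (w n) := (wE n).1.
have cw : infimums (range (fun n => N (v - w n))) c.
  have -> : (fun n => N (v - w n)) = s by apply/funext => n; case: (wE n).
  by rewrite sE.
have c0 : 0 <= c by apply: cglb => _ [u _ <-]; exact: nm_ge0 hN _.
have cC u : C u -> c <= N (v - u) by move=> Cu; apply: clb; exists u.
pose h := N (v - w 0%N); have ch : c <= h by exact: cC.
have h0 : 0 <= h := nm_ge0 hN _.
have near_min t : exists u, C u /\ (0 < t -> N (v - u) <= c + t *: h).
  have [t0|t0] := ltP 0 t; last by exists (w 0%N).
  have [|u Cu ut] := glue_near_inf hA hi hj hUV hN _ Cw cw t0.
    by rewrite Cglue.
  by exists u.
have /choice[W WP] := near_min.
have CW t : C (W t) := (WP t).1.
have WE t : 0 < t -> N (v - W t) <= c + t *: h := (WP t).2.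
pose q : Z := 6 *: sqr_in j jZ h.
have sqr_bound s' t u u' : 0 <= s' <= 1 -> 0 <= t <= 1 -> C u -> C u' ->
    N (v - u) <= c + s' *: h -> N (v - u') <= c + t *: h ->
    dH u u' ^+ 2 <= dZ ((s' + t) *: q) 0.
  move=> s01 t01 Cu Cu' us ut.
  have -> : dH u u' = dH (u - u') 0 by rewrite !dHE subr0.
  apply: le_trans (hd _) _; apply: (mr_monotone dZr).
    rewrite -(solid_ge0 hjZ) mul_inE ?fmul_ge0// ?(solid_ge0 hj) ?(nm_ge0 hN)//.
  exact: (parallelogram_near_inf hi hj hjZ hUV _ hN hpar Cconvex cC c0 ch
    s01 t01 Cu Cu' us ut).
have Wcauchy : cauchy ((W : R -> metr dH) t @[t --> 0^'+]).
  apply: cauchy_exP => e e0.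
  have e20 : 0 < e ^+ 2 / 2 by rewrite divr_gt0 ?exprn_gt0.
  have sm : \forall t \near (0:R)^'+,
      [/\ 0 < t, t < 1 & dZ (t *: q) 0 < e ^+ 2 / 2].
    near=> t; split; near: t; [exact: nbhs_right_gt|exact: nbhs_right_lt|].
    exact: near_scale mZ e20.
  have [r [r0 r1 rq]] := filter_ex sm.
  exists (W r); apply: filterS sm => t [t0 t1 tq].
  rewrite /= ballEmdist /= /mdist /=.
  rewrite -(@ltr_pXn2r _ 2) ?nnegrE ?dist_ge0 ?(ltW e0)//.
  apply: le_lt_trans
    (sqr_bound r t _ _ _ _ (CW r) (CW t) (WE _ r0) (WE _ t0)) _.
  - by rewrite !ltW.
  - by rewrite !ltW.
  - rewrite scalerDl (le_lt_trans (dist_add0 _ _ dZr))//.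
    by rewrite [ltRHS]splitr ltrD.
have [p Wp] := Hcomplete _ _ Wcauchy.
have Cp : C p.
  apply: (@closed_cvg R (metr dH) _ _ W C Cclosed _ p Wp).
  by apply: nearW => t; exact: CW.
have pc : c = N (v - p).
  apply/esym/(dist_positivity (d := dV))/eqP.
  rewrite eq_le dist_ge0 andbT; apply/ler_addgt0Pr => e e0; rewrite add0r.
  have e20 : 0 < e / 2 by rewrite divr_gt0.
  have sm : \forall t \near (0:R)^'+,
      [/\ 0 < t, dV (t *: h) 0 < e / 2 & dH p (W t) < e / 2].
    near=> t; split; near: t; [exact: nbhs_right_gt|exact: near_scale mV e20|].
    exact: metricType_numDomainType.cvgr_dist_lt Wp _ e20.
  have [t [t0 th tp]] := filter_ex sm.
  rewrite -(distB0 _ _ dVr) (@le_trans _ _ (dV (t *: h + N (p - W t)) 0))//.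
    apply: (mr_monotone dVr); first by rewrite rsub_ge0 cC.
    rewrite rleBlDr addrAC [t *: h + c]addrC.
    apply: le_trans (rleD (WE t t0) (lexx _)).
    rewrite (normBC hj hUV hN p); apply: le_trans (nm_triangle hN _ _).
    by rewrite addrA subrK.
  rewrite (le_trans (dist_add0 _ _ dVr))// [leRHS]splitr lerD ?(ltW th)//.
  by rewrite -dHE ltW.
exists c; split=> //.
  apply/eqP; rewrite eq_le; apply/andP; split.
    apply: lb_le_inf; first by exists (dH v p), p.
    by move=> _ [u Cu <-]; rewrite dHE; apply: (mr_monotone dVr) => //; exact: cC.
  rewrite pc -dHE; apply: ge_inf; last by exists p.
  by exists 0 => _ [u _ <-]; exact: dist_ge0.
exists p; split=> // p' [Cp' pc'].
apply: (dist_positivity (d := dH)); apply/eqP.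
rewrite -sqrf_eq0 eq_le sqr_ge0 andbT.
(* [p] and [p'] are minimising for [s = t = 0]. *)
have := sqr_bound 0 0 p p' _ _ Cp Cp'.
rewrite addr0 !scale0r distxx addr0; apply; by rewrite ?lexx ?ler01 -?pc -?pc'.
Unshelve. all: by end_near. Qed.
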